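(* Let $m \geq 2$, let the symmetric group $S_{2m+1}$ act on the standard representation $E = \mathbf{C}^{2m}$, and put $V = \Lambda^m E$. Then $V$ is irreducible, and for $U = \Lambda^m W$ with $W \leq E$ a hyperplane (linear subspace of codimension one), $$\dim U = \dim V/2, \quad \mathrm{diam}_+^{S_{2m+1}}(V, U) \geq m+1, \quad \mathsf{R}(V, U) \geq \frac{m+1}{2} > \frac{\ln \dim V}{4 \ln 2},$$ and consequently $\mathsf{C}(V) \geq \ln \dim V/(4 \ln 2)$.
   Context: The standard representation of $S_n$ is the $(n-1)$-dimensional space of vectors in $\mathbf{C}^n$ with coordinate sum zero, with $S_n$ permuting coordinates. For a group $H$ acting linearly on a finite-dimensional complex vector space $V$ and a nonzero subspace $U \leq V$, the group-additive diameter is $$\mathrm{diam}_+^{H}(V,U) = \min\{ m \mid g_1\cdot U + \dots + g_m\cdot U = V \text{ for some } g_1,\dots,g_m \in H\}.$$ If $H$ acts irreducibly on $V$, put $\mathsf{R}(V,U) = \mathrm{diam}_+^{H}(V,U) / \lceil \dim V/\dim U\rceil$, and the covering complexity of $V$ (with respect to $H$) is $\mathsf{C}(V) = \max_{0 \neq U \leq V} \mathsf{R}(V,U)$. In the claim $H = S_{2m+1}$. *)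

(* Defs.v *)
From HB Require Import structures.
From mathcomp Require Import all_boot all_order all_algebra all_fingroup.
From mathcomp Require Import mxrepresentation complex.
From mathcomp Require Import boolp classical_sets functions cardinality reals exp.

Set Implicit Arguments.
Unset Strict Implicit.
Unset Printing Implicit Defensive.

Import Order.TTheory GRing.Theory Num.Theory.
Local Open Scope ring_scope.

(* As in mxrepresentation, subspaces of F^n are row spaces of matrices, and    *)
(* groups act on row vectors by v |-> v *m rG g.                              *)

Section TensorPower.
Variable F : fieldType.

(* The k-th tensor power of F^n is 'rV[F]_(tens_dim k n): its basis vectors    *)
(* e_(f 0) (x) ... (x) e_(f k.-1) are indexed by the maps f from 'I_k to 'I_n. *)
Definition tens_dim (k n : nat) : nat := #|{ffun 'I_k -> 'I_n}|.

Definition tens_idx (k n : nat) (b : 'I_(tens_dim k n)) : {ffun 'I_k -> 'I_n} :=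
  enum_val b.

Lemma tens_idx_inj k n : injective (@tens_idx k n).
Proof. exact: enum_val_inj. Qed.

Lemma tens_idxK k n : cancel (@enum_rank {ffun 'I_k -> 'I_n}) (@tens_idx k n).
Proof. exact: enum_rankK. Qed.

(* v_0 (x) ... (x) v_(k-1), for the rows v_i of v *)
Definition tens_vec (k n : nat) (v : 'M[F]_(k, n)) : 'rV[F]_(tens_dim k n) :=
  \row_b \prod_(i < k) v i (tens_idx b i).

Definition tens_mx (k p n : nat) (A : 'M[F]_(p, n)) :
    'M[F]_(tens_dim k p, tens_dim k n) :=
  \matrix_a tens_vec (rowsub (tens_idx a) A).

(* In characteristic 0, the k-th exterior power is the space of antisymmetric *)
(* tensors, the span of the v_0 /\ ... /\ v_(k-1).                            *)
Definition wedge (k n : nat) (v : 'M[F]_(k, n)) : 'rV[F]_(tens_dim k n) :=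
  \sum_(s : 'S_k) (-1) ^+ s *: tens_vec (row_perm s v).

(* The row space of ext_pow k U is the k-th exterior power of that of U; the  *)
(* spanning family consists of the exterior products of k rows of U, and      *)
(* ext_pow_min shows that the choice of spanning rows is irrelevant.          *)
Definition ext_pow (k p n : nat) (U : 'M[F]_(p, n)) :
    'M[F]_(tens_dim k p, tens_dim k n) :=
  \matrix_a wedge (rowsub (tens_idx a) U).

Lemma tens_vecM k p n (v : 'M[F]_(k, p)) (B : 'M[F]_(p, n)) :
  tens_vec (v *m B) = tens_vec v *m tens_mx k B.
Proof.
apply/rowP=> b; rewrite !mxE.
under eq_bigr do rewrite mxE.
rewrite bigA_distr_bigA /= (reindex (@tens_idx k p)) /=; last first.
  by exists enum_rank => a _; rewrite /tens_idx ?enum_valK ?enum_rankK.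
apply: eq_bigr => a _.
rewrite big_split /= !mxE; congr (_ * _).
by apply: eq_bigr => i _; rewrite mxE.
Qed.

Lemma tens_mxM k p q n (A : 'M[F]_(p, q)) (B : 'M[F]_(q, n)) :
  tens_mx k (A *m B) = tens_mx k A *m tens_mx k B.
Proof.
apply/row_matrixP=> a; rewrite row_mul !rowK -tens_vecM; congr tens_vec.
by rewrite -mul_rowsub_mx.
Qed.

Lemma tens_mx1 k n : tens_mx k (1%:M : 'M[F]_n) = 1%:M.
Proof.
apply/matrixP=> a b; rewrite !mxE.
have [->|neq_ab] := eqVneq a b.
  by apply: big1 => i _; rewrite !mxE eqxx.
have [i neq_i] : exists i, tens_idx a i != tens_idx b i.
  apply/existsP; rewrite -negb_forall; apply: contra neq_ab => /forallP eq_ab.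
  by apply/eqP/tens_idx_inj/ffunP=> i; apply/eqP.
by rewrite (bigD1 i) //= !mxE (negPf neq_i) mul0r.
Qed.

Lemma wedgeM k p n (v : 'M[F]_(k, p)) (B : 'M[F]_(p, n)) :
  wedge (v *m B) = wedge v *m tens_mx k B.
Proof.
rewrite /wedge mulmx_suml; apply: eq_bigr => s _.
by rewrite -scalemxAl -tens_vecM !row_permE mulmxA.
Qed.

Lemma wedge_mul k p n (v : 'M[F]_(k, p)) (U : 'M[F]_(p, n)) :
  wedge (v *m U) = tens_vec v *m ext_pow k U.
Proof.
rewrite [LHS]/wedge.
under eq_bigr => s _ do rewrite row_permE mulmxA -row_permE.
apply/rowP=> b; rewrite summxE [RHS]mxE.
under [RHS]eq_bigr => a _ do rewrite !mxE summxE mulr_sumr.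
rewrite exchange_big /=; apply: eq_bigr => s _.
rewrite tens_vecM mxE mxE mulr_sumr.
pose h (a : 'I_(tens_dim k p)) : 'I_(tens_dim k p) :=
  enum_rank [ffun i => tens_idx a (s i)].
rewrite (reindex h) /=; last first.
  exists (fun a => enum_rank [ffun i => tens_idx a ((s^-1)%g i)]) => a _;
    rewrite /h; apply: tens_idx_inj; rewrite !tens_idxK; apply/ffunP=> i;
    by rewrite !ffunE ?permKV ?permK.
apply: eq_bigr => a _; rewrite !mxE mulrCA; congr (_ * _).
  rewrite (reindex_inj (@perm_inj _ (s^-1)%g)) /=.
  apply: eq_bigr => i _.
  by rewrite /h tens_idxK ffunE !mxE !permKV.
congr (_ * _).
by apply: eq_bigr => i _; rewrite /h tens_idxK !mxE ffunE.
Qed.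

Lemma ext_pow_min k p n q (U : 'M[F]_(p, n)) (L : 'M[F]_(q, tens_dim k n)) :
  (ext_pow k U <= L)%MS <->
  (forall v : 'M[F]_(k, n), (v <= U)%MS -> (wedge v <= L)%MS).
Proof.
split=> [sUL v /submxP[D ->] | sUL].
  by rewrite wedge_mul; apply: submx_trans sUL; apply: submxMl.
by apply/row_subP=> a; rewrite rowK; apply: sUL; apply: rowsub_sub.
Qed.

Variables (gT : finGroupType) (G : {group gT}) (n : nat).
Variable rG : mx_representation F G n.

Lemma tens_repr_subproof k : mx_repr G (fun g => tens_mx k (rG g)).
Proof.
split=> [|g h Gg Gh]; first by rewrite repr_mx1 tens_mx1.
by rewrite repr_mxM // tens_mxM.
Qed.

Definition tens_repr k : mx_representation F G (tens_dim k n) :=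
  MxRepresentation (tens_repr_subproof k).

End TensorPower.

Section SymmetricGroup.
Variables (F : fieldType) (n : nat).

Lemma perm_repr_subproof :
  mx_repr [set: 'S_n] (fun s => perm_mx s : 'M[F]_n).
Proof. by split=> [|s t _ _]; [exact: perm_mx1 | exact: perm_mxM]. Qed.

(* s sends the i-th vector of the standard basis to the (s i)-th one *)
Definition perm_repr : mx_representation F [set: 'S_n]%G n :=
  MxRepresentation perm_repr_subproof.

(* the vectors of coordinate sum zero *)
Definition std_mx : 'M[F]_n := kermx (const_mx 1 : 'cV[F]_n).

Lemma std_mxP (v : 'rV[F]_n) : (v <= std_mx)%MS = (\sum_i v 0 i == 0).
Proof.
apply/sub_kermxP/eqP => [/matrixP/(_ 0 0)|sum0].
  by rewrite !mxE; under eq_bigr do rewrite mxE mulr1.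
apply/matrixP=> i j; rewrite !ord1 !mxE -[RHS]sum0.
by apply: eq_bigr => l _; rewrite mxE mulr1.
Qed.

Lemma mxrank_std : \rank std_mx = n.-1.
Proof.
rewrite mxrank_ker -mxrank_tr rank_rV; case: n => [|k]; first by [].
by case: eqP => [/rowP/(_ 0)/eqP|_]; rewrite ?mxE ?oner_eq0 ?subn1.
Qed.

End SymmetricGroup.

Section CoveringComplexity.
Variables (F : fieldType) (gT : finGroupType) (G : {group gT}) (n : nat).
Variable rG : mx_representation F G n.

Definition covers (V U : 'M[F]_n) (k : nat) :
    bool :=
  [exists g : {ffun 'I_k -> gT},
    [forall i, g i \in G] && (\sum_i U *m rG (g i) == V)%MS].

(* The value is 0 when no sum of translates of U is V, which cannot happen    *)
(* for V simple and 0 != U <= V.                                              *)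
Definition diam (V U : 'M[F]_n) : nat :=
  if pselect (exists k, covers V U k) is left ex then ex_minn ex else 0%N.

Definition cov_ratio (R : realType) (V U : 'M[F]_n) : R :=
  (diam V U)%:R / (Num.ceil ((\rank V)%:R / (\rank U)%:R : R))%:~R.

(* The supremum is a maximum, by cov_complexity_max. *)
Definition cov_complexity (R : realType) (V : 'M[F]_n) : R :=
  sup [set cov_ratio R V U | U in [set U : 'M[F]_n | U != 0 /\ (U <= V)%MS]]%classic.

Lemma diam_le (V U : 'M[F]_n) :
  (diam V U <= #|G|)%N.
Proof.
rewrite /diam; case: pselect => // ex; case: ex_minnP => k cov_k min_k.
have /existsP[g /andP[/forallP Gg /eqmxP defV]] := cov_k.
pose h := [ffun i : 'I_#|codom g| => enum_val i].
suff cov_h : covers V U #|codom g|.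
  apply: leq_trans (min_k _ cov_h) (subset_leq_card _).
  by apply/fintype.subsetP=> _ /codomP[i ->].
apply/existsP; exists h; apply/andP; split.
  apply/forallP=> i; rewrite ffunE.
  by have /codomP[j ->] := enum_valP i.
suff eq_sum : (\sum_i U *m rG (h i) :=: \sum_i U *m rG (g i))%MS.
  by apply/eqmxP; apply: eqmx_trans eq_sum defV.
apply/eqmxP/andP; split; apply/sumsmx_subP=> i _.
  by rewrite ffunE; have /codomP[j ->] := enum_valP i; apply: (sumsmx_sup j).
have gi : g i \in codom g by apply: codom_f.
by apply: (sumsmx_sup (enum_rank_in gi (g i))); rewrite // ffunE enum_rankK_in.
Qed.

Lemma cov_complexity_max (R : realType) (V : 'M[F]_n) :
  V != 0 ->
  (exists U : 'M[F]_n,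
    [/\ U != 0, (U <= V)%MS & cov_ratio R V U = cov_complexity R V]) /\
  (forall U : 'M[F]_n, U != 0 -> (U <= V)%MS ->
    cov_ratio R V U <= cov_complexity R V).
Proof.
move=> nzV; rewrite /cov_complexity; set S := (X in sup X).
pose val (a : 'I_#|G|.+1 * 'I_n.+1) : R :=
  a.1%:R / (Num.ceil ((\rank V)%:R / (a.2)%:R : R))%:~R.
have valP (U : 'M[F]_n) : exists a, cov_ratio R V U = val a.
  exists (inord (diam V U), inord (\rank U)).
  by rewrite /val /= !inordK // ltnS ?diam_le ?rank_leq_col.
have U0V : (<<V>> : 'M[F]_n)%MS != 0 /\ (<<V>> <= V)%MS.
  by rewrite -!submx0 !genmxE submx0.
have [a0 def_a0] := valP <<V>>%MS.
have Pa0 : `[< S (val a0) >] by apply/asboolP; exists <<V>>%MS.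
have [a /asboolP[U [nzU sUV] defU] max_a] :=
  @arg_maxP _ _ _ a0 (fun a => `[< S (val a) >]) val Pa0.
have ubS : ubound S (val a).
  move=> _ [U' U'P <-]; have [a' def_a'] := valP U'.
  by rewrite def_a'; apply: max_a; apply/asboolP; exists U'.
have Sa : S (val a) by exists U.
have -> : sup S = val a.
  apply/eqP; rewrite eq_le; apply/andP; split.
    by apply: ge_sup => //; exists (val a).
  by apply: ub_le_sup => //; exists (val a).
split; first by exists U.
by move=> U' nzU' sU'V; apply: ubS; exists U'.
Qed.

End CoveringComplexity.

(* Main.v *)
Require Import Defs.
From mathcomp Require Import all_boot all_order all_algebra all_fingroup.
From mathcomp Require Import pgroup primitive_action alt zify lra.
From mathcomp Require Import mxrepresentation complex.
From mathcomp Require Import reals exp.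

Import Order.TTheory GRing.Theory Num.Theory.
Local Open Scope ring_scope.

Set Implicit Arguments.
Unset Strict Implicit.
Unset Printing Implicit Defensive.

(** Dimensions. The coordinates of an exterior product are the maximal minors
of the matrix of its factors (wedgeE). Hence, for a subspace of dimension d,
the exterior products of k increasing basis vectors are a basis of the k-th
exterior power, which has dimension 'C(d, k) (mxrank_ext_pow). For a
hyperplane W of E this gives 'C(2m - 1, m) = 'C(2m, m) / 2.

Diameter. Consider at most m hyperplanes of the 2m-dimensional space E. Their
intersection has dimension at least m, so it contains some K of dimension
exactly m. In E / K, of dimension m, the hyperplanes become proper subspaces,
so that their m-th exterior powers vanish, while that of E / K does not.
Therefore the m-th exterior powers of the hyperplanes do not add up to that of
E (sum_ext_pow_hyperplanes), and m + 1 translates of U are necessary. The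
diameter is a genuine minimum because the sum of all translates of U is a
nonzero submodule of the simple module V (mxsimple_covers).

Irreducibility. Write k for the exterior degree and let S_(k+1) permute the
first k + 1 points. Its antisymmetrizer P maps every product
e_(a 1) /\ ... /\ e_(a k) to a multiple of one vector: if two of the k + 1
points are missing from a, their transposition fixes the product, which P then
kills; otherwise a lists all but one of the k + 1 points, and any two such
lists differ by an element of S_(k+1) and a reordering. On the other hand
z = (e_1 - e_0) /\ ... /\ (e_k - e_0) lies in the exterior power V of E, is
multiplied by (k + 1)! under P, and its translates span V. So P V is the line
of z. Given a nonzero submodule U of V, Maschke provides an invariant
complement U'. If U P is nonzero then z is in U, so U = V. If U P = 0, then
(k + 1)! z = z P is in U', so U' contains V, hence U, and U = 0: a
contradiction.

Numbers. The ratio of dimensions is 2, and dim V = 'C(2m, m) <= 2 ^ (2m) gives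
ln (dim V) / (4 ln 2) <= m / 2. *)

(** * Exterior powers and their dimension *)

Section ExteriorPowers.
Variable F : fieldType.

(** Coordinates of an exterior product are minors, so that alternation and
signs are inherited from the determinant. *)
Lemma wedgeE k n (v : 'M[F]_(k, n)) b :
  wedge v 0 b = \det (colsub (tens_idx b) v).
Proof.
rewrite -det_tr summxE; apply: eq_bigr => s _.
by rewrite !mxE; congr (_ * _); apply: eq_bigr => i _; rewrite !mxE.
Qed.

Lemma wedge_row_perm k n (s : 'S_k) (v : 'M[F]_(k, n)) :
  wedge (row_perm s v) = (-1) ^+ s *: wedge v.
Proof.
apply/rowP=> b; rewrite mxE !wedgeE -det_perm -det_mulmx -row_permE.
by congr (\det _); apply/matrixP=> i j; rewrite !mxE.
Qed.

Lemma wedge_alternate k n (v : 'M[F]_(k, n)) i j :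
  i != j -> row i v = row j v -> wedge v = 0.
Proof.
move=> neq_ij /rowP eq_ij; apply/rowP=> b; rewrite wedgeE mxE.
apply: (determinant_alternate neq_ij) => l.
by have := eq_ij (tens_idx b l); rewrite !mxE.
Qed.

Lemma ext_powM k p q n (A : 'M[F]_(p, q)) (B : 'M[F]_(q, n)) :
  ext_pow k (A *m B) = ext_pow k A *m tens_mx k B.
Proof.
by apply/row_matrixP=> a; rewrite row_mul !rowK -wedgeM mul_rowsub_mx.
Qed.

Lemma wedge_sub k p n (v : 'M[F]_(k, n)) (U : 'M[F]_(p, n)) :
  (v <= U)%MS -> (wedge v <= ext_pow k U)%MS.
Proof. by case/submxP=> D ->; rewrite wedge_mul submxMl. Qed.

Lemma ext_powS k p q n (A : 'M[F]_(p, n)) (B : 'M[F]_(q, n)) :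
  (A <= B)%MS -> (ext_pow k A <= ext_pow k B)%MS.
Proof.
by move=> sAB; apply/ext_pow_min=> v svA; apply/wedge_sub/(submx_trans svA).
Qed.

Lemma eqmx_ext_pow k p q n (A : 'M[F]_(p, n)) (B : 'M[F]_(q, n)) :
  (A :=: B)%MS -> (ext_pow k A :=: ext_pow k B)%MS.
Proof.
by move=> eqAB; apply/eqmxP; rewrite !ext_powS ?eqAB.
Qed.

Definition basis_wedge k n (a : 'I_k -> 'I_n) :=
  wedge (rowsub a (1%:M : 'M[F]_n)).

Lemma basis_wedgeE k n (a : 'I_k -> 'I_n) b :
  basis_wedge a 0 b = \det (\matrix_(i, j) (a i == tens_idx b j)%:R).
Proof.
by rewrite [LHS]wedgeE; congr (\det _); apply/matrixP=> i j; rewrite !mxE.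
Qed.

Lemma eq_basis_wedge k n (a b : 'I_k -> 'I_n) :
  a =1 b -> basis_wedge a = basis_wedge b.
Proof.
by move=> eq_ab; congr wedge; apply/matrixP=> i j; rewrite !mxE eq_ab.
Qed.

Lemma basis_wedge_perm k n (a : 'I_k -> 'I_n) (s : 'S_k) :
  basis_wedge (a \o s) = (-1) ^+ s *: basis_wedge a.
Proof.
rewrite -wedge_row_perm; congr wedge.
by apply/matrixP=> i j; rewrite !mxE.
Qed.

Lemma basis_wedge_noninj k n (a : 'I_k -> 'I_n) :
  ~~ injectiveb a -> basis_wedge a = 0.
Proof.
case/injectivePn=> i [j neq_ij eq_a].
by apply: (wedge_alternate neq_ij); rewrite !row_rowsub eq_a.
Qed.

Lemma row_ext_pow1 k n a :
  row a (ext_pow k (1%:M : 'M[F]_n)) = basis_wedge (tens_idx a).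
Proof. exact: rowK. Qed.

(** Among the products of standard basis vectors, those with strictly
increasing indices span, since reordering only changes signs; and they are
independent, since their coordinates at increasing multi-indices form the
identity matrix. *)
Lemma mxrank_ext_pow1 k n : \rank (ext_pow k (1%:M : 'M[F]_n)) = 'C(n, k).
Proof.
rewrite -card_ltn_sorted_tuples; set D := [set t | _].
have memD t : (t \in D) = sorted ltn (map val t) by rewrite inE.
pose tup (l : 'I_#|D|) : k.-tuple 'I_n := enum_val l.
pose idx l := enum_rank [ffun i => tnth (tup l) i].
have idxE l : tens_idx (idx l) =1 tnth (tup l).
  by move=> i; rewrite tens_idxK ffunE.
have sortedD l : sorted ltn (map val (tup l)).
  by have := enum_valP l; rewrite memD.
have uniqD l : uniq (tup l).
  by rewrite -(map_inj_uniq val_inj) (sorted_uniq ltn_trans ltnn).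
pose M : 'M[F]_(#|D|, _) := rowsub idx (ext_pow k (1%:M : 'M[F]_n)).
have M_sub : colsub idx M = 1%:M.
  apply/matrixP=> l l'.
  have -> : colsub idx M l l' = basis_wedge (tens_idx (idx l)) 0 (idx l').
    by rewrite 3!mxE.
  rewrite basis_wedgeE !mxE; have [<-|neq_ll'] := eqVneq l l'.
    rewrite -[RHS](det1 F k); congr (\det _); apply/matrixP=> i j.
    by rewrite !mxE !idxE (inj_eq (tuple_uniqP _ (uniqD l))).
  (* Distinct increasing tuples have distinct ranges; a value of the first
     that the second misses gives a zero row in the minor. *)
  have [i ti_notin] : exists i, tnth (tup l) i \notin tup l'.
    apply/existsP; apply: contraNT neq_ll'; rewrite negb_exists => /forallP sub.
    apply/eqP/enum_val_inj/val_inj/(inj_map val_inj).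
    apply: (irr_sorted_eq ltn_trans ltnn (sortedD l) (sortedD l')).
    apply: eq_mem_map; apply: (uniq_min_size _ _ _).2 => //.
      by move=> x /tnthP[i ->]; have := sub i; rewrite negbK.
    by rewrite !size_tuple.
  rewrite (expand_det_row _ i) big1 // => j _.
  rewrite !mxE !idxE; case: eqP => [eq_t|_]; last by rewrite mul0r.
  by rewrite eq_t mem_tnth in ti_notin.
apply/eqP; rewrite eqn_leq; apply/andP; split.
  apply: leq_trans (rank_leq_row M); apply: mxrankS; apply/row_subP=> a.
  rewrite row_ext_pow1; set f := tens_idx a.
  have [inj_f|/basis_wedge_noninj->] := boolP (injectiveb f);
    last exact: sub0mx.
  pose t := mktuple f.
  have uniq_t : uniq t.
    by apply/tuple_uniqP=> i j; rewrite !tnth_mktuple; apply/injectiveP.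
  have /tuple_permP[s def_s] : perm_eq (sort (relpre val leq) t) t.
    by rewrite perm_sort.
  set u := mktuple _ in def_s; have uD : u \in D.
    rewrite memD -def_s ltn_sorted_uniq_leq (map_inj_uniq val_inj) sort_uniq.
    rewrite uniq_t sorted_map /=; apply: sort_sorted => x y.
    exact: leq_total.
  rewrite (_ : basis_wedge f = (-1) ^+ s *: basis_wedge (f \o s)); last first.
    by rewrite basis_wedge_perm scalerA -expr2 sqrr_sign scale1r.
  apply: scalemx_sub.
  rewrite (_ : basis_wedge (f \o s) = row (enum_rank_in uD u) M).
    exact: row_sub.
  rewrite row_rowsub row_ext_pow1; apply: eq_basis_wedge => i.
  by rewrite idxE /tup enum_rankK_in // !tnth_mktuple.
rewrite -[X in (X <= _)%N](mxrank1 F) -M_sub -{1}[M]mulmx1 -mulmx_colsub.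
by apply: leq_trans (mxrankM_maxl _ _) _; apply/mxrankS/rowsub_sub.
Qed.

(** A basis of the space embeds the exterior power of the coordinate space,
because a right inverse of the basis matrix induces one on tensors. *)
Lemma mxrank_ext_pow k p n (U : 'M[F]_(p, n)) :
  \rank (ext_pow k U) = 'C(\rank U, k).
Proof.
rewrite -(eqmx_ext_pow k (eq_row_base U)) -[row_base U]mul1mx ext_powM.
rewrite mxrankMfree ?mxrank_ext_pow1 //; apply/row_freeP.
have /row_freeP[B defB] := row_base_free U.
by exists (tens_mx k B); rewrite -tens_mxM defB tens_mx1.
Qed.

End ExteriorPowers.

(** * Exterior powers of few hyperplanes *)

Section Hyperplanes.
Variables (F : fieldType) (n : nat).

(** Cutting with one more hyperplane lowers the dimension by at most one. *)
Lemma mxrank_capmx_hyperplanes (E : 'M[F]_n) k (W : 'I_k -> 'M[F]_n) :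
    (forall i, (W i <= E)%MS) -> (forall i, (\rank (W i)).+1 = \rank E) ->
  (\rank E <= \rank (E :&: \bigcap_i W i) + k)%N.
Proof.
elim: k W => [|k IHk] W sWE rkW; first by rewrite big_ord0 capmx1 addn0.
rewrite big_ord_recr /=; set K := (\bigcap_i _)%MS.
have /= := IHk _ (fun i => sWE (widen_ord (leqnSn k) i)) (fun i => rkW _).
rewrite -/K => leEK; set w := W ord_max.
have := mxrank_sum_cap (E :&: K)%MS w.
have -> : \rank (E :&: (K :&: w)) = \rank (E :&: K :&: w).
  by rewrite capmxA.
have : (\rank (E :&: K + w) <= \rank E)%N.
  by apply: mxrankS; rewrite addsmx_sub capmxSl sWE.
have := rkW ord_max; rewrite -/w; move: leEK; clear; lia.
Qed.

Lemma submx_of_rank p (A : 'M[F]_(p, n)) r :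
  (r <= \rank A)%N -> exists2 B : 'M[F]_n, (B <= A)%MS & \rank B = r.
Proof.
move=> le_rA; exists <<(pid_mx r : 'M_(n, \rank A)) *m row_base A>>%MS.
  by rewrite genmxE (submx_trans (submxMl _ _)) ?eq_row_base.
rewrite genmxE mxrankMfree ?row_base_free // rank_pid_mx //.
exact: leq_trans le_rA (rank_leq_col _).
Qed.

(** Multiplication by cokermx K is the passage to the quotient by K. *)
Lemma mxrank_mul_coker p (A : 'M[F]_(p, n)) (K : 'M[F]_n) :
  (K <= A)%MS -> (\rank (A *m cokermx K) + \rank K)%N = \rank A.
Proof.
move=> sKA; rewrite -(mxrank_mul_ker A (cokermx K)); congr (_ + _)%N.
have eqK : (kermx (cokermx K) :=: K)%MS.
  apply/eqmxP/andP; split; first by rewrite submxE mulmx_ker.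
  by apply/sub_kermxP; rewrite mulmx_coker.
by rewrite (cap_eqmx (eqmx_refl A) eqK) (capmx_idPr sKA).
Qed.

(** In the quotient of E by an m-codimensional K contained in all the W i,
E becomes m-dimensional and the W i smaller, so that the m-th exterior power
of E survives and those of the W i vanish. *)
Lemma sum_ext_pow_hyperplanes (E : 'M[F]_n) m k (W : 'I_k -> 'M[F]_n) :
    (forall i, (W i <= E)%MS) -> (forall i, (\rank (W i)).+1 = \rank E) ->
    (k <= m <= \rank E)%N ->
  ~~ (ext_pow m E <= \sum_i ext_pow m (W i))%MS.
Proof.
move=> sWE rkW /andP[le_km le_mE]; set d := \rank E in le_mE rkW.
have [|K sK rkK] := @submx_of_rank _ (E :&: \bigcap_i W i)%MS (d - m).
  by have := mxrank_capmx_hyperplanes sWE rkW; lia.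
have sKE : (K <= E)%MS by rewrite (submx_trans sK) ?capmxSl.
apply/negP=> /(submxMr (tens_mx m (cokermx K))).
have -> : (\sum_i ext_pow m (W i))%MS *m tens_mx m (cokermx K) = 0.
  apply/sub_kermxP/sumsmx_subP=> i _; apply/sub_kermxP.
  rewrite -ext_powM; apply/eqP; rewrite -mxrank_eq0 mxrank_ext_pow bin_small //.
  have sKW : (K <= W i)%MS.
    apply: submx_trans sK _; apply: submx_trans (capmxSr _ _) _.
    exact: (bigcapmx_inf i).
  by have := mxrank_mul_coker sKW; have := rkW i; lia.
rewrite -ext_powM submx0 -mxrank_eq0 mxrank_ext_pow.
have -> : \rank (E *m cokermx K) = m by have := mxrank_mul_coker sKE; lia.
by rewrite binn.
Qed.

End Hyperplanes.

(** * Exterior products of differences *)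

Section DifferenceWedge.
Variable F : fieldType.

(** (X_1 - X_0) /\ ... /\ (X_k - X_0), for the rows X_i of X. *)
Definition diff_wedge k n (X : 'M[F]_(1 + k, n)) : 'rV[F]_(tens_dim k n) :=
  wedge (dsubmx X - const_mx 1 *m usubmx X).

(** Prepending a column of ones to the rows of X turns the minor of
differences into a determinant in which the base row X_0 is on the same
footing as the other ones; this makes the antisymmetry in all k + 1 rows
visible. *)
Lemma diff_wedgeE k n (X : 'M[F]_(1 + k, n)) b :
  diff_wedge X 0 b = \det (row_mx (const_mx 1) (colsub (tens_idx b) X)).
Proof.
(* L subtracts the top row from all the other ones. *)
set A := row_mx _ _.
pose L := block_mx 1%:M 0 (- const_mx 1) 1%:M : 'M[F]_(1 + k).
rewrite -[RHS]mul1r.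
have <- : \det L = 1 by rewrite det_lblock !det1 mulr1.
rewrite -det_mulmx [diff_wedge _ _ _]wedgeE.
have -> : A = block_mx 1%:M (usubmx (colsub (tens_idx b) X))
                       (const_mx 1) (dsubmx (colsub (tens_idx b) X)).
  rewrite block_mxEh vsubmxK; congr row_mx; apply/matrixP=> i j.
  by rewrite !mxE; case: split => i'; rewrite !mxE ?ord1.
rewrite mulmx_block !mul1mx !mul0mx !addr0 mulmx1 addNr det_ublock det1 mul1r.
congr (\det _); apply/matrixP=> i j; rewrite !mxE [RHS]addrC; congr (_ + _).
by rewrite !big_ord1 !mxE mulNr.
Qed.

Lemma diff_wedgeM k p n (X : 'M[F]_(1 + k, p)) (B : 'M[F]_(p, n)) :
  diff_wedge (X *m B) = diff_wedge X *m tens_mx k B.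
Proof.
rewrite /diff_wedge -wedgeM mulmxBl -mulmxA; congr wedge.
by rewrite -[X in X *m B]vsubmxK mul_col_mx col_mxKu col_mxKd.
Qed.

Lemma diff_wedge_row_perm k n (s : 'S_(1 + k)) (X : 'M[F]_(1 + k, n)) :
  diff_wedge (row_perm s X) = (-1) ^+ s *: diff_wedge X.
Proof.
apply/rowP=> b; rewrite mxE !diff_wedgeE -det_perm -det_mulmx -row_permE.
congr (\det _); apply/matrixP=> i j; rewrite !mxE.
by case: split => j'; rewrite !mxE.
Qed.

Lemma diff_wedge_alternate k n (X : 'M[F]_(1 + k, n)) i j :
  i != j -> row i X = row j X -> diff_wedge X = 0.
Proof.
move=> neq_ij /rowP eq_ij; apply/rowP=> b; rewrite diff_wedgeE mxE.
apply: (determinant_alternate neq_ij) => l; rewrite !mxE.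
case: split => l'; rewrite !mxE //.
by have := eq_ij (tens_idx b l'); rewrite !mxE.
Qed.

End DifferenceWedge.

(** * Extending permutations *)

(** This is the k-transitivity of the full symmetric group. *)
Lemma perm_extending (T : finType) k (f g : 'I_k -> T) :
  injective f -> injective g -> exists s : {perm T}, forall i, s (f i) = g i.
Proof.
move=> inj_f inj_g.
have le_kT : (k <= #|T|)%N.
  by rewrite -[k]card_ord -(card_codom inj_f) max_card.
have in_dtuple (h : 'I_k -> T) :
    injective h -> mktuple h \in k.-dtuple([set: T]).
  move=> inj_h; apply/dtuple_onP; split=> [i j|i]; last by rewrite inE.
  by rewrite !tnth_mktuple => /inj_h.
have trT := ntransitive_weak le_kT (Sym_trans T).
have [s _ def_g] := atransP2 trT (in_dtuple f inj_f) (in_dtuple g inj_g).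
exists s => i; have := congr1 (fun t => tnth t i) def_g.
by rewrite tnth_mktuple tnth_map tnth_mktuple.
Qed.

Section ExtendPerm.
Variables (k r : nat).

Definition extend_fun (t : 'S_k) (i : 'I_(k + r)) : 'I_(k + r) :=
  match split i with inl j => lshift r (t j) | inr j => rshift k j end.

Lemma extend_fun_inj t : injective (extend_fun t).
Proof.
move=> i j; rewrite /extend_fun; case: (split_ordP i) => i' ->;
  case: (split_ordP j) => j' ->;
  rewrite ?(unsplitK (inl _)) ?(unsplitK (inr _)).
- by move/lshift_inj/perm_inj->.
- by move/eqP; rewrite eq_lrshift.
- by move/eqP; rewrite eq_rlshift.
- by move/rshift_inj->.
Qed.

Definition extend_perm t : 'S_(k + r) := perm (@extend_fun_inj t).

Lemma extend_perm_lshift t i : extend_perm t (lshift r i) = lshift r (t i).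
Proof. by rewrite permE /extend_fun (unsplitK (inl i)). Qed.

Lemma extend_perm_rshift t i : extend_perm t (rshift k i) = rshift k i.
Proof. by rewrite permE /extend_fun (unsplitK (inr i)). Qed.

Lemma extend_permM t u :
  extend_perm (t * u) = (extend_perm t * extend_perm u)%g.
Proof.
apply/permP=> i; rewrite permM; case: (split_ordP i) => j ->.
  by rewrite !extend_perm_lshift permM.
by rewrite !extend_perm_rshift.
Qed.

End ExtendPerm.

(** * Irreducibility of the exterior powers of the standard representation *)

Section Irreducibility.
Variable F : fieldType.
Hypothesis charF0 : [pchar F] =i pred0.

Let natF0 i : (i%:R == 0 :> F) = (i == 0%N).
Proof. exact: (pcharf0P F).1. Qed.

Lemma rowsub1_perm k n (a : 'I_k -> 'I_n) (s : 'S_n) :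
  rowsub a 1%:M *m perm_mx s = rowsub (s \o a) (1%:M : 'M[F]_n).
Proof. by apply/matrixP=> i j; rewrite mul_rowsub_mx mul1mx !mxE. Qed.

Lemma basis_wedgeM k n (a : 'I_k -> 'I_n) (s : 'S_n) :
  basis_wedge F a *m tens_mx k (perm_mx s) = basis_wedge F (s \o a).
Proof. by rewrite -wedgeM rowsub1_perm. Qed.

Lemma std_mx_stable n (s : 'S_n) : (std_mx F n *m perm_mx s <= std_mx F n)%MS.
Proof.
apply/sub_kermxP; rewrite -mulmxA.
have -> : perm_mx s *m const_mx 1 = const_mx 1 :> 'cV[F]_n.
  by rewrite -row_permE; apply/matrixP=> i j; rewrite !mxE.
exact: mulmx_ker.
Qed.

Section Antisymmetrizer.
Variables k r : nat.
Let n := ((1 + k) + r)%N.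

Definition antisym : 'M[F]_(tens_dim k n) :=
  \sum_(t : 'S_(1 + k)) (-1) ^+ t *: tens_mx k (perm_mx (extend_perm r t)).

(** Left translation by t permutes the terms of the antisymmetrizer, up to
the sign of t. *)
Lemma antisym_absorb t :
  tens_mx k (perm_mx (extend_perm r t)) *m antisym = (-1) ^+ t *: antisym.
Proof.
rewrite /antisym mulmx_sumr scaler_sumr [RHS](reindex_inj (mulgI t)) /=.
apply: eq_bigr => u _; rewrite -scalemxAr -tens_mxM -perm_mxM -extend_permM.
by rewrite scalerA odd_permM signr_addb mulrA -expr2 sqrr_sign mul1r.
Qed.

Let first_wedge := basis_wedge F (lshift r \o lift (ord0 : 'I_(1 + k))).

(** Either a misses two of the first k + 1 points, and the transposition of
these shows that the image is its own opposite; or a enumerates all but one of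
them, and the enumeration of all but the first one can be moved onto it. *)
Lemma basis_wedge_antisym (a : 'I_k -> 'I_n) :
  (basis_wedge F a *m antisym <= first_wedge *m antisym)%MS.
Proof.
have [/existsP[x /existsP[y /and3P[neq_xy ax ay]]]|] :=
  boolP [exists x, exists y,
    [&& x != y, lshift r x \notin codom a & lshift r y \notin codom a]].
  have fix_a :
      basis_wedge F a *m tens_mx k (perm_mx (extend_perm r (tperm x y)))
      = basis_wedge F a.
    rewrite basis_wedgeM; apply: eq_basis_wedge => i /=.
    have := codom_f a i; case: (split_ordP (a i)) => j -> a_j.
      by rewrite extend_perm_lshift tpermD //; [apply: contraNneq ax => -> |
         apply: contraNneq ay => ->].
    by rewrite extend_perm_rshift.
  have := congr1 (mulmx^~ antisym) fix_a; rewrite /= -mulmxA antisym_absorb.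
  rewrite odd_tperm neq_xy expr1 scaleN1r mulmxN => /eqP.
  rewrite eq_sym -subr_eq0 opprK -mulr2n -scaler_nat scaler_eq0.
  by rewrite natF0 /= => /eqP->; rewrite sub0mx.
rewrite negb_exists => /forallP cov_a.
(* The one of the first k + 1 points that a misses. The default value stands
   for the impossible case where a hits all of them, in which the rest of the
   argument goes through unchanged. *)
pose x := odflt ord0 [pick x | lshift r x \notin codom a].
have a_onto j : lshift r (lift x j) \in codom a.
  have := neq_lift x j; rewrite /x; case: pickP => /= [x' ax' neq_x'|a_all _].
    have := cov_a x'; rewrite negb_exists => /forallP/(_ (lift x' j)).
    by rewrite neq_x' ax' /= negbK.
  exact: negbFE (a_all (lift ord0 j)).
pose f j := iinv (a_onto j).
have af j : a (f j) = lshift r (lift x j) by apply: f_iinv.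
have inj_f : injective f.
  by move=> i j /(congr1 a); rewrite !af => /lshift_inj/lift_inj.
pose s := perm inj_f; pose u := lift_perm ord0 x (1%g : 'S_k).
have -> : basis_wedge F a = (-1) ^+ s *: basis_wedge F (a \o s).
  by rewrite basis_wedge_perm scalerA -expr2 sqrr_sign scale1r.
have -> : basis_wedge F (a \o s) =
          first_wedge *m tens_mx k (perm_mx (extend_perm r u)).
  rewrite basis_wedgeM; apply: eq_basis_wedge => i /=.
  by rewrite permE af extend_perm_lshift lift_perm_lift perm1.
by rewrite -scalemxAl -mulmxA antisym_absorb -scalemxAr !scalemx_sub.
Qed.

(** (e_1 - e_0) /\ ... /\ (e_k - e_0), the differences being taken among the
first k + 1 points. *)
Definition std_wedge : 'rV[F]_(tens_dim k n) :=
  diff_wedge (rowsub (lshift r) (1%:M : 'M[F]_n)).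

(** A permutation of the first k + 1 points multiplies std_wedge by its
signature, so each term of the antisymmetrizer contributes std_wedge itself. *)
Lemma std_wedge_antisym :
  std_wedge *m antisym = #|{perm 'I_(1 + k)}|%:R *: std_wedge.
Proof.
rewrite mulmx_sumr -sumr_const scaler_suml; apply: eq_bigr => t _.
rewrite -scalemxAr -diff_wedgeM rowsub1_perm.
have -> : rowsub (extend_perm r t \o lshift r) (1%:M : 'M[F]_n)
        = row_perm t (rowsub (lshift r) 1%:M).
  by apply/matrixP=> i j; rewrite !mxE /= extend_perm_lshift.
by rewrite diff_wedge_row_perm scalerA -expr2 sqrr_sign.
Qed.

Let nz_card : #|{perm 'I_(1 + k)}|%:R != 0 :> F.
Proof. by rewrite natF0 -lt0n; apply/card_gt0P; exists 1%g. Qed.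

Lemma diff_wedge_sub_std (X : 'M[F]_(1 + k, n)) :
    X *m const_mx 1 = const_mx 1 :> 'cV_(1 + k) ->
  (diff_wedge X <= ext_pow k (std_mx F n))%MS.
Proof.
rewrite -{1}[X]vsubmxK mul_col_mx -[RHS]vsubmxK => /eq_col_mx[uX1 dX1].
apply/wedge_sub/sub_kermxP; rewrite mulmxBl -mulmxA uX1 dX1.
by apply/matrixP=> i j; rewrite !mxE big_ord1 !mxE mulr1 subrr.
Qed.

Lemma std_wedge_sub : (std_wedge <= ext_pow k (std_mx F n))%MS.
Proof.
apply: diff_wedge_sub_std; rewrite mul_rowsub_mx mul1mx.
by apply/matrixP=> i j; rewrite !mxE.
Qed.

Let rho := tens_repr (perm_repr F n) k.

(** The differences e_i - e_0 span the standard representation; a product of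
k of them is zero or has distinct factors e_(a j) - e_0 with a j <> 0, and then
some permutation carries std_wedge to it. *)
Lemma std_wedge_generates (U : 'M[F]_(tens_dim k n)) :
  mxmodule rho U -> (std_wedge <= U)%MS -> (ext_pow k (std_mx F n) <= U)%MS.
Proof.
move=> modU zU; pose o : 'I_n := lshift r ord0.
pose D : 'M[F]_n := 1%:M - const_mx 1 *m row o 1%:M.
have sED : (std_mx F n <= D)%MS.
  apply/rV_subP=> v /sub_kermxP v1; apply/submxP; exists v.
  by rewrite mulmxBr mulmx1 mulmxA v1 mul0mx subr0.
apply: submx_trans (ext_powS k sED) _; apply/row_subP=> a; rewrite rowK.
pose g (i : 'I_(1 + k)) : 'I_n :=
  match split i with inl _ => o | inr j => tens_idx a j end.
have -> : wedge (rowsub (tens_idx a) D) = diff_wedge (rowsub g 1%:M).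
  congr wedge; apply/matrixP=> i j; rewrite !mxE !big_ord1 !mxE.
  by rewrite /g (unsplitK (inl _)) (unsplitK (inr _)).
have [/injectiveP inj_g|/injectivePn[i [j neq_ij eq_g]]] :=
  boolP (injectiveb g).
  have [s def_g] := perm_extending (@lshift_inj _ _) inj_g.
  have -> : diff_wedge (rowsub g 1%:M) = std_wedge *m rho s.
    rewrite -diff_wedgeM rowsub1_perm; congr diff_wedge.
    by apply/matrixP=> i j; rewrite !mxE /= def_g.
  by apply: mxmodule_trans; rewrite ?inE.
rewrite (diff_wedge_alternate neq_ij) ?sub0mx //.
by rewrite !row_rowsub eq_g.
Qed.

Lemma mxmodule_antisym p (U : 'M[F]_(p, tens_dim k n)) :
  mxmodule rho U -> (U *m antisym <= U)%MS.
Proof.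
move=> /mxmoduleP modU; rewrite mulmx_sumr; apply: summx_sub => t _.
by rewrite -scalemxAr scalemx_sub // modU ?inE.
Qed.

Lemma ext_pow_std_neq0 : ext_pow k (std_mx F n) != 0.
Proof. by rewrite -mxrank_eq0 mxrank_ext_pow mxrank_std -lt0n bin_gt0; lia. Qed.

Lemma std_wedge_neq0 : std_wedge != 0.
Proof.
apply: contra_neq ext_pow_std_neq0 => z0; apply/eqP; rewrite -submx0.
by apply: std_wedge_generates; rewrite ?mxmodule0 // z0 sub0mx.
Qed.

(** The image of the antisymmetrizer lies on one line, by
basis_wedge_antisym, and this line is that of std_wedge, which is nonzero and
is multiplied by (k + 1)!. *)
Lemma ext_pow_antisym p (A : 'M[F]_(p, n)) :
  (ext_pow k A *m antisym <= std_wedge)%MS.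
Proof.
have in_line p' (A' : 'M_(p', n)) :
    (ext_pow k A' *m antisym <= first_wedge *m antisym)%MS.
  apply: submx_trans (submxMr _ (ext_powS k (submx1 A'))) _.
  apply/row_subP=> a; rewrite row_mul row_ext_pow1.
  exact: basis_wedge_antisym.
apply: submx_trans (in_line _ _) _.
have : (std_wedge <= first_wedge *m antisym)%MS.
  rewrite -(eqmx_scale _ nz_card) -std_wedge_antisym.
  exact: submx_trans (submxMr _ std_wedge_sub) (in_line _ _).
case/sub_rVP=> c def_z; have nz_c : c != 0.
  by apply: contra_neq std_wedge_neq0 => c0; rewrite def_z c0 scale0r.
by rewrite def_z eqmx_scale.
Qed.

(** The antisymmetrizer detects std_wedge in a submodule or in its Maschke
complement, and std_wedge generates everything. The number of points is
written (1 + k) + r to make the first k + 1 of them a summand. *)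
Lemma ext_pow_std_simple_shift : mxsimple rho (ext_pow k (std_mx F n)).
Proof.
set V := ext_pow k _.
have modV : mxmodule rho V.
  apply/mxmoduleP=> s _; rewrite /= -ext_powM.
  exact/ext_powS/std_mx_stable.
split=> // [|U modU sUV nzU]; first exact: ext_pow_std_neq0.
have [UP0|nzUP] := eqVneq (U *m antisym) 0; last first.
  apply: std_wedge_generates => //; apply: submx_trans (mxmodule_antisym modU).
  have sUPz : (U *m antisym <= std_wedge)%MS.
    exact: submx_trans (submxMr _ sUV) (ext_pow_antisym _).
  rewrite -(geq_leqif (mxrank_leqif_sup sUPz)).
  by rewrite (leq_trans (rank_leq_row _)) // lt0n mxrank_eq0.
have [|U' modU' defV dxU] := mx_Maschke_pchar rho _ modU (submx1 U).
  by rewrite /pgroup pcharf'_nat natF0 -lt0n cardG_gt0.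
suff zU' : (std_wedge <= U')%MS.
  have sUU' : (U <= U')%MS.
    exact: submx_trans sUV (std_wedge_generates modU' zU').
  case/negP: nzU; rewrite -submx0 -(mxdirect_addsP dxU).
  by rewrite sub_capmx submx_refl.
have /sub_addsmxP[[a b] /= def_z] : (std_wedge <= U + U')%MS.
  by rewrite defV submx1.
rewrite -(eqmx_scale _ nz_card) -std_wedge_antisym def_z mulmxDl -!mulmxA UP0.
rewrite mulmx0 add0r (submx_trans (submxMl _ _)) //.
exact: mxmodule_antisym.
Qed.

End Antisymmetrizer.
End Irreducibility.

Lemma ext_pow_std_simple (F : fieldType) n k :
    [pchar F] =i pred0 -> (k < n)%N ->
  mxsimple (tens_repr (perm_repr F n) k) (ext_pow k (std_mx F n)).
Proof.
move=> charF0 /subnKC <-; exact: ext_pow_std_simple_shift.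
Qed.

(** * Covering by translates *)

(** The sum of all the translates is a nonzero submodule. *)
Lemma mxsimple_covers (F : fieldType) (gT : finGroupType) (G : {group gT})
    n (rG : mx_representation F G n) (V U : 'M[F]_n) :
  mxsimple rG V -> U != 0 -> (U <= V)%MS -> exists k, covers rG V U k.
Proof.
move=> [modV _ minV] nzU sUV; exists #|G|; apply/existsP.
pose g := [ffun i : 'I_#|G| => enum_val i]; exists g.
have Gg i : g i \in G by rewrite ffunE enum_valP.
rewrite (introT forallP Gg) /=; set S := (\sum_i _)%MS.
have sub_S x : x \in G -> (U *m rG x <= S)%MS.
  move=> Gx; apply: (sumsmx_sup (enum_rank_in Gx x)) => //.
  by rewrite ffunE enum_rankK_in.
apply/andP; split.
  by apply/sumsmx_subP=> i _; apply: mxmodule_trans.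
apply: minV.
- apply/mxmoduleP=> x Gx; rewrite sumsmxMr; apply/sumsmx_subP=> i _.
  by rewrite -mulmxA -repr_mxM // sub_S ?groupM.
- by apply/sumsmx_subP=> i _; apply: mxmodule_trans.
- apply: contraNneq nzU => S0.
  by have := sub_S _ (group1 G); rewrite S0 repr_mx1 mulmx1 submx0.
Qed.

(** Translates of the exterior power of W are exterior powers of translates
of W, which are again hyperplanes of E. *)
Lemma ltn_diam_ext_pow (F : fieldType) (gT : finGroupType) (G : {group gT})
    n (rG : mx_representation F G n) m (E W : 'M[F]_n) :
    mxmodule rG E -> mxsimple (tens_repr rG m) (ext_pow m E) ->
    (W <= E)%MS -> (\rank W).+1 = \rank E -> (m <= \rank W)%N ->
  (m < diam (tens_repr rG m) (ext_pow m E) (ext_pow m W))%N.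
Proof.
move=> modE simV sWE rkW le_mW; rewrite /diam.
case: boolp.pselect => [|[]]; last first.
  apply: mxsimple_covers simV _ (ext_powS m sWE).
  by rewrite -mxrank_eq0 mxrank_ext_pow -lt0n bin_gt0.
move=> ex; case: ex_minnP => k /existsP[g /andP[/forallP Gg /andP[_ sV]]] _.
rewrite ltnNge; apply/negP=> le_km.
have Wg i : (W *m rG (g i) <= E)%MS by apply: mxmodule_trans.
have rkWg i : (\rank (W *m rG (g i))).+1 = \rank E.
  by rewrite mxrankMfree // row_free_unit repr_mx_unit.
have /negP[] : ~~ (ext_pow m E <= \sum_i ext_pow m (W *m rG (g i)))%MS.
  by apply: sum_ext_pow_hyperplanes; rewrite // le_km -rkW leqW.
by under eq_bigr do rewrite ext_powM.
Qed.

(** * Central binomial coefficients and the main result *)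

Lemma bin_double m : (0 < m)%N -> 'C(2 * m, m) = (2 * 'C((2 * m).-1, m))%N.
Proof.
move=> m_gt0; apply/eqP; rewrite -(eqn_pmul2l m_gt0) mulnCA mulnA.
by rewrite mul_bin_down; apply/eqP; congr (_ * _)%N; lia.
Qed.

Lemma leq_bin_exp2 n k : ('C(n, k) <= 2 ^ n)%N.
Proof.
have [lt_nk|le_kn] := ltnP n k; first by rewrite bin_small.
rewrite -[2%N]/(1 + 1)%N Pascal (bigD1 (Ordinal (le_kn : k < n.+1))%N) //=.
by rewrite !exp1n !muln1 leq_addr.
Qed.

Theorem proposition5p12 (R : realType) (m : nat) (m_ge2 : (2 <= m)%N) :
  let n := (2 * m + 1)%N in
  let C : fieldType := R[i] in
  let E : 'M[C]_n := std_mx C n in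
  let rho := tens_repr (perm_repr C n) m in
  let V := ext_pow m E in
  [/\ mxsimple rho V,
      forall W : 'M[C]_n, (W <= E)%MS -> (\rank W).+1 = \rank E ->
        let U := ext_pow m W in
        [/\ (\rank U)%:R = (\rank V)%:R / 2 :> R,
            (m + 1 <= diam rho V U)%N,
            (m%:R + 1) / 2 <= cov_ratio rho R V U
          & ln (\rank V)%:R / (4 * ln 2) < (m%:R + 1) / 2 :> R]
    & ln (\rank V)%:R / (4 * ln 2) <= cov_complexity rho R V].
Proof.
move=> n C E rho V.
have rkE : \rank E = (2 * m)%N by rewrite mxrank_std /n addn1.
have rkV : \rank V = 'C(2 * m, m) by rewrite mxrank_ext_pow rkE.
have simV : mxsimple rho V.
  by apply: ext_pow_std_simple; [exact: pchar_num | rewrite /n; lia].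
have ln_bound : ln (\rank V)%:R / (4 * ln 2) < (m%:R + 1) / 2 :> R.
  have ln2_gt0 : 0 < ln 2 :> R by rewrite ln_gt0 ?ltr1n.
  have V_gt0 : 0 < (\rank V)%:R :> R by rewrite ltr0n rkV bin_gt0; lia.
  have : ln (\rank V)%:R <= ln (2 ^+ (2 * m)) :> R.
    by rewrite ler_ln ?posrE ?exprn_gt0 // -natrX ler_nat rkV leq_bin_exp2.
  rewrite lnXn ?ltr0n // -[ln 2 *+ _]mulr_natl natrM => le_ln.
  rewrite ltr_pdivrMr; last by lra.
  by apply: le_lt_trans le_ln _; lra.
have hyperplane W : (W <= E)%MS -> (\rank W).+1 = \rank E ->
    let U := ext_pow m W in
    [/\ (\rank U)%:R = (\rank V)%:R / 2 :> R,
        (m + 1 <= diam rho V U)%N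
      & (m%:R + 1) / 2 <= cov_ratio rho R V U].
  move=> sWE rkW U.
  have rkU : (\rank V)%:R = 2 * (\rank U)%:R :> R.
    rewrite rkV bin_double; last lia.
    rewrite natrM mxrank_ext_pow; congr (_ * 'C(_, _)%:R).
    by rewrite -rkE -rkW.
  have U_gt0 : 0 < (\rank U)%:R :> R.
    by rewrite ltr0n mxrank_ext_pow bin_gt0; lia.
  have diamU : (m + 1 <= diam rho V U)%N.
    rewrite addn1; apply: ltn_diam_ext_pow => //; last by lia.
    by apply/mxmoduleP=> s _; apply: std_mx_stable.
  split=> //; first by rewrite rkU; lra.
  rewrite /cov_ratio rkU mulfK ?gt_eqF // ceilK ?natr_int //.
  by rewrite ler_pM2r ?invr_gt0 ?ltr0n // natr1 -addn1 ler_nat.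
split=> // [W sWE rkW U|].
  by have [] := hyperplane W sWE rkW.
have [|W sWE rkW] := @submx_of_rank _ _ _ E (2 * m).-1; first by lia.
have {}rkW : (\rank W).+1 = \rank E by lia.
have [rkU _ le_ratio] := hyperplane W sWE rkW.
apply/ltW/(lt_le_trans ln_bound)/(le_trans le_ratio).
have nzV : V != 0 by case: simV.
apply: (cov_complexity_max rho R nzV).2; last exact: ext_powS.
rewrite -mxrank_eq0 -(eqr_nat R) rkU mulf_eq0 negb_or.
by rewrite pnatr_eq0 mxrank_eq0 nzV invr_eq0 pnatr_eq0.
Qed.
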